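(* Let $(\alpha,\beta,u,v,x)$ be a GSVD component of $(A,B)$. The scaled right generalized singular vector $x_\alpha=\frac{x}{\alpha}$ satisfies $$\|x_\alpha\|\ge\frac{1}{\|A\|}.$$ Let $z=\frac{1}{\sqrt2}\begin{bmatrix}v\\ x_\alpha\end{bmatrix}$ be the corresponding eigenvector of $(\widetilde B,\widetilde A)$, and let $\widetilde z$ be an approximate eigenvector, written as $\widetilde z=\frac1{\sqrt2}\begin{bmatrix}\widetilde v\\ \widetilde x\end{bmatrix}$ with $\widetilde v\in\mathbb{R}^p$, $\|\widetilde v\|=1$, and $0\neq\widetilde x\in\mathbb{R}^n$. Set $\widetilde u=\frac{A\widetilde x}{\|A\widetilde x\|}$. Then the approximate generalized singular vectors $\widetilde u,\widetilde v,\widetilde x$ satisfy $$\sin\angle(\widetilde x,x)\le\sqrt{1+\frac{1}{\|x_\alpha\|^2}}\,\sin\angle(\widetilde z,z),$$ $$\sin\angle(\widetilde v,v)\le\sqrt{1+\|x_\alpha\|^2}\,\sin\angle(\widetilde z,z),$$ $$\sin\angle(\widetilde u,u)\le\|A\|\sqrt{1+\|x_\alpha\|^2}\,\sin\angle(\widetilde z,z).$$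
   Context: $\|\cdot\|$ is the 2-norm. $A\in\mathbb{R}^{m\times n}$ ($m\ge n$) and $B\in\mathbb{R}^{p\times n}$ ($p\ge n$) have full column rank $n$. The GSVD of $(A,B)$ is $A=UCX^{-1}$, $B=VSX^{-1}$ with $C=\mathrm{diag}\{\alpha_1,\dots,\alpha_n\}$, $S=\mathrm{diag}\{\beta_1,\dots,\beta_n\}$, $\alpha_i,\beta_i>0$, $\alpha_i^2+\beta_i^2=1$, $X=[x_1,\dots,x_n]$ nonsingular, and $U=[u_1,\dots,u_n]$, $V=[v_1,\dots,v_n]$ with orthonormal columns. Each $(\alpha_i,\beta_i,u_i,v_i,x_i)$ is a GSVD component; a generic one is written $(\alpha,\beta,u,v,x)$, and $\sigma=\alpha/\beta$. Here $$\widetilde B=\begin{bmatrix}0&B\\ B^T&0\end{bmatrix},\quad \widetilde A=\begin{bmatrix}I_p&0\\ 0&A^TA\end{bmatrix},$$ and $\widetilde Bz=\frac1\sigma\widetilde Az$. $\angle(a,b)$ is the acute angle between the lines spanned by nonzero vectors $a,b$, so $\sin\angle(a,b)=\min_{\mu\in\mathbb R}\|b-\mu a\|/\|b\|$. ''Approximate'' carries no quantitative hypothesis. *)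

(* Defs.v *)
From mathcomp Require Import all_boot all_order all_algebra.
From mathcomp Require Import all_classical all_reals all_analysis.

Set Implicit Arguments.
Unset Strict Implicit.
Unset Printing Implicit Defensive.

Import Order.TTheory GRing.Theory Num.Theory.

Local Open Scope classical_set_scope.
Local Open Scope ring_scope.

Section Norms.
Variable R : realType.

(* The norm `|x| that the library puts on matrices is the max norm, so the
   Euclidean norm is defined here. *)
Definition norm2 n (x : 'cV[R]_n) : R := Num.sqrt (\sum_i x i 0 ^+ 2).

Definition mxnorm2 m n (A : 'M[R]_(m, n)) : R :=
  sup [set norm2 (A *m x) | x in [set x : 'cV[R]_n | norm2 x <= 1]].

(* Acute angle (in [0, pi / 2]) between the lines spanned by a and b, which are
   meant to be nonzero. *)
Definition angle n (a b : 'cV[R]_n) : R :=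
  acos (`|(a^T *m b) 0 0| / (norm2 a * norm2 b)).

End Norms.

Section GSVD.
Variables (R : realType) (m n p : nat).
Implicit Types (A : 'M[R]_(m, n)) (B : 'M[R]_(p, n)).

(* Thin form: only the n columns of U and V that occur in a component are kept.
   The rows al and be hold the diagonals of C and S. *)
Definition is_gsvd A B (U : 'M[R]_(m, n)) (V : 'M[R]_(p, n)) (X : 'M[R]_n)
    (al be : 'rV[R]_n) : Prop :=
  [/\ U^T *m U = 1%:M,
      V^T *m V = 1%:M,
      X \in unitmx,
      forall i, [/\ 0 < al 0 i, 0 < be 0 i & al 0 i ^+ 2 + be 0 i ^+ 2 = 1] &
      A = U *m diag_mx al *m invmx X /\ B = V *m diag_mx be *m invmx X].

Definition gsvd_component A B (a b : R)
    (u : 'cV[R]_m) (v : 'cV[R]_p) (x : 'cV[R]_n) : Prop :=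
  exists U V X al be, is_gsvd A B U V X al be /\
    exists i, [/\ a = al 0 i, b = be 0 i,
                  u = col i U, v = col i V & x = col i X].

Definition Btilde B : 'M[R]_(p + n) := block_mx 0 B B^T 0.

Definition Atilde A : 'M[R]_(p + n) := block_mx 1%:M 0 0 (A^T *m A).

End GSVD.

(* (lam, z) is an eigenpair of the matrix pair (M, N): M z = lam N z, z != 0. *)
Definition pair_eigen (R : realType) k (M N : 'M[R]_k) (lam : R) (z : 'cV[R]_k)
  : Prop := z != 0 /\ M *m z = lam *: (N *m z).

(* Main.v *)
Require Import Defs.
From mathcomp Require Import all_boot all_order all_algebra.
From mathcomp Require Import all_classical all_reals all_analysis.
From mathcomp Require Import ring.
Import Order.TTheory GRing.Theory Num.Theory.
Local Open Scope ring_scope.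

Set Implicit Arguments.
Unset Strict Implicit.
Unset Printing Implicit Defensive.

(** The proof rests on one fact about angles: among the residuals
    [b - mu *: a], the shortest has length [norm2 b * sin (angle a b)].
    This holds because the residual splits orthogonally into the component of
    [b] off the line of [a] and a multiple of [a] ([norm2_sub_pythagoras]).
    It serves in both directions: any [mu] bounds a sine from above
    ([norm2_sin_angle_le]), and some [mu] realises it
    ([norm2_sin_angle_attained]).

    The factorisation gives [A *m xa = u] and [B *m xa = (beta / alpha) *: v],
    with [u] and [v] of norm 1.  The bound [1 <= mxnorm2 A * norm2 xa] follows
    at once, and together with the transposed relation between [A^T *m u] and
    [B^T *m v] so does the eigenvalue equation.

    For the three sine bounds, choose the one [mu] that is optimal for the
    stacked vectors, so that the stacked residual
    [col_mx (v - mu *: vt) (xa - mu *: xt)] has length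
    [D = Num.sqrt (1 + norm2 xa ^+ 2) * sin (angle zt z)]; the radical is the
    norm of [col_mx v xa].  Each block has length at most [D]
    ([sin_angle_col_mx_residual]), and the same [mu] tested on each pair of
    blocks gives the sines for [x] (after division by [norm2 xa]) and for [v].
    For [u], the residual [u - mu *: (A *m xt)] is the image under [A] of
    [xa - mu *: xt], hence of length at most [mxnorm2 A * D]. *)

(** * Euclidean norm and sine of the angle between two lines *)

Section EuclideanNorm.
Variables (R : realType) (n : nat).
Implicit Types (a b : 'cV[R]_n) (mu : R).

Lemma norm2_ge0 a : 0 <= norm2 a.
Proof. exact: sqrtr_ge0. Qed.

Lemma dot_sum a b : (a^T *m b) 0 0 = \sum_i a i 0 * b i 0.
Proof. by rewrite mxE; apply: eq_bigr => i _; rewrite mxE. Qed.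

Lemma sqr_norm2 a : norm2 a ^+ 2 = \sum_i a i 0 ^+ 2.
Proof. by rewrite sqr_sqrtr ?sumr_ge0 // => i _; rewrite sqr_ge0. Qed.

Lemma norm2_eq0 a : (norm2 a == 0) = (a == 0).
Proof.
rewrite -sqrf_eq0 sqr_norm2 psumr_eq0 => [|i _]; last by rewrite sqr_ge0.
apply/allP/eqP => [a0|-> i _]; last by rewrite mxE expr0n /= eqxx.
apply/matrixP => i j; rewrite ord1 mxE; apply/eqP; rewrite -sqrf_eq0.
by apply: a0; rewrite mem_index_enum.
Qed.

Lemma norm2_0 : norm2 (0 : 'cV[R]_n) = 0.
Proof. by apply/eqP; rewrite norm2_eq0. Qed.

Lemma norm2Z mu a : norm2 (mu *: a) = `|mu| * norm2 a.
Proof.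
rewrite /norm2 -sqrtr_sqr -sqrtrM ?sqr_ge0 // mulr_sumr.
by congr Num.sqrt; apply: eq_bigr => i _; rewrite mxE exprMn.
Qed.

Lemma norm2_scale_normalize a : norm2 a *: ((norm2 a)^-1 *: a) = a.
Proof.
have [->|a0] := eqVneq a 0; first by rewrite !scaler0.
by rewrite scalerA divff ?norm2_eq0 // scale1r.
Qed.

Lemma sqr_norm2_subZ mu a b :
  norm2 (b - mu *: a) ^+ 2
  = norm2 b ^+ 2 - mu * (a^T *m b) 0 0 *+ 2 + mu ^+ 2 * norm2 a ^+ 2.
Proof.
rewrite !sqr_norm2 dot_sum !mulr_sumr -sumrMnl -sumrB -big_split /=.
by apply: eq_bigr => i _; rewrite !mxE; ring.
Qed.

(** Cauchy-Schwarz: the residual at the optimal multiple of [a] has a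
    nonnegative squared norm. *)
Lemma sqr_dot_le a b : (a^T *m b) 0 0 ^+ 2 <= norm2 a ^+ 2 * norm2 b ^+ 2.
Proof.
have [->|a0] := eqVneq a 0.
  by rewrite trmx0 mul0mx mxE expr0n mulr_ge0 ?sqr_ge0.
have na0 : 0 < norm2 a ^+ 2 by rewrite exprn_even_gt0 //= norm2_eq0.
have := sqr_ge0 (norm2 (b - ((a^T *m b) 0 0 / norm2 a ^+ 2) *: a)).
rewrite sqr_norm2_subZ -(pmulr_rge0 _ na0) -[X in _ -> is_true X]subr_ge0.
set d := (_ *m _) 0 0.
by move: (norm2 a ^+ 2) na0 => N N0; congr (_ <= _); field; rewrite gt_eqF.
Qed.

(** Cauchy-Schwarz places the argument of [acos] in its domain.  If one of the
    vectors is zero, the inverse of [0] being [0] makes that argument [0], so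
    the angle is [pi / 2] and both sides are [1]. *)
Lemma sin_angleE a b :
  sin (angle a b)
  = Num.sqrt (1 - (a^T *m b) 0 0 ^+ 2 / (norm2 a ^+ 2 * norm2 b ^+ 2)).
Proof.
have [ab0|ab0] := eqVneq (norm2 a * norm2 b) 0.
  rewrite /angle -exprMn ab0 expr0n invr0 !mulr0 acos0 sin_pihalf subr0.
  by rewrite sqrtr1.
have nab : 0 < norm2 a * norm2 b by rewrite lt0r ab0 mulr_ge0 ?norm2_ge0.
rewrite sin_acos; first by rewrite expr_div_n real_normK ?num_real // exprMn.
apply/andP; split.
  by rewrite (le_trans (lerN10 _)) // divr_ge0 // ltW.
rewrite ler_pdivrMr // mul1r -(@ler_pXn2r _ 2) ?nnegrE ?(ltW nab) //.
by rewrite real_normK ?num_real // exprMn sqr_dot_le.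
Qed.

Lemma sin_angle_ge0 a b : 0 <= sin (angle a b).
Proof. by rewrite sin_angleE sqrtr_ge0. Qed.

(** The quotient below is the coefficient of the orthogonal projection of [b]
    on [a], so the last term measures how far [mu *: a] is from that
    projection.  Zero vectors are covered: the sine is then [1] and the
    inner product vanishes. *)
Lemma norm2_sub_pythagoras mu a b :
  norm2 (b - mu *: a) ^+ 2
  = (norm2 b * sin (angle a b)) ^+ 2
    + norm2 a ^+ 2 * (mu - (a^T *m b) 0 0 / norm2 a ^+ 2) ^+ 2.
Proof.
have [a0|a0] := eqVneq (norm2 a ^+ 2) 0.
  rewrite sqr_norm2_subZ sin_angleE a0 !mul0r invr0 !mulr0 subr0 sqrtr1 mulr1.
  have := sqr_dot_le a b; rewrite a0 mul0r exprn_even_le0 //= => /eqP ->.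
  by rewrite mulr0 mul0rn subr0.
have [b0|b0] := eqVneq (norm2 b ^+ 2) 0.
  rewrite sqr_norm2_subZ exprMn b0 !mul0r.
  have := sqr_dot_le a b; rewrite b0 mulr0 exprn_even_le0 //= => /eqP ->.
  by rewrite mul0r mulr0 mul0rn !subr0 !add0r mulrC.
rewrite sqr_norm2_subZ exprMn sin_angleE (@sqr_sqrtr _ (1 - _)).
  by field; rewrite -!(sqrf_eq0 (norm2 _)) a0 b0.
rewrite subr_ge0 ler_pdivrMr ?mul1r ?sqr_dot_le //.
by rewrite lt0r mulf_neq0 //= mulr_ge0 // sqr_ge0.
Qed.

Lemma norm2_sin_angle_le mu a b :
  norm2 b * sin (angle a b) <= norm2 (b - mu *: a).
Proof.
rewrite -(@ler_pXn2r _ 2) ?nnegrE ?mulr_ge0 ?norm2_ge0 ?sin_angle_ge0 //.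
by rewrite norm2_sub_pythagoras lerDl mulr_ge0 // sqr_ge0.
Qed.

Lemma norm2_sin_angle_attained a b :
  exists mu, norm2 b * sin (angle a b) = norm2 (b - mu *: a).
Proof.
exists ((a^T *m b) 0 0 / norm2 a ^+ 2); apply/eqP.
rewrite -(@eqrXn2 _ 2) ?mulr_ge0 ?norm2_ge0 ?sin_angle_ge0 //.
by rewrite norm2_sub_pythagoras subrr expr0n mulr0 addr0.
Qed.

Lemma angleC a b : angle a b = angle b a.
Proof.
rewrite /angle !dot_sum [norm2 a * _]mulrC; congr (acos (`|_| / _)).
by apply: eq_bigr => i _; rewrite mulrC.
Qed.

Lemma sin_angleZr c a b : c != 0 -> sin (angle a (c *: b)) = sin (angle a b).
Proof.
move=> c0; rewrite !sin_angleE -scalemxAr norm2Z !mxE !exprMn.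
rewrite real_normK ?num_real //.
by rewrite [_ * (c ^+ 2 * _)]mulrCA -mulf_div divff ?mul1r // sqrf_eq0.
Qed.

Lemma sin_angleZl c a b : c != 0 -> sin (angle (c *: a) b) = sin (angle a b).
Proof. by move=> c0; rewrite angleC sin_angleZr // angleC. Qed.

End EuclideanNorm.

(** * Block vectors and the operator norm *)

Lemma sqr_norm2_col_mx (R : realType) k l (a : 'cV[R]_k) (b : 'cV[R]_l) :
  norm2 (col_mx a b) ^+ 2 = norm2 a ^+ 2 + norm2 b ^+ 2.
Proof.
rewrite !sqr_norm2 big_split_ord /=.
by congr (_ + _); apply: eq_bigr => i _; rewrite ?col_mxEu ?col_mxEd.
Qed.

(** Cauchy-Schwarz on each row.  The constant, the Frobenius norm, is crude; it
    only has to show that the set whose supremum is [mxnorm2 A] is bounded. *)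
Lemma norm2_mul_le_frobenius (R : realType) m n (A : 'M[R]_(m, n))
    (x : 'cV[R]_n) :
  norm2 (A *m x) <= Num.sqrt (\sum_i norm2 (row i A)^T ^+ 2) * norm2 x.
Proof.
have F0 : 0 <= \sum_i norm2 (row i A)^T ^+ 2.
  by apply: sumr_ge0 => i _; apply: sqr_ge0.
rewrite -(@ler_pXn2r _ 2) ?nnegrE ?mulr_ge0 ?norm2_ge0 ?sqrtr_ge0 //.
rewrite exprMn (sqr_sqrtr F0) sqr_norm2 mulr_suml; apply: ler_sum => i _.
have -> : (A *m x) i 0 = ((row i A)^T^T *m x) 0 0.
  by rewrite trmxK -row_mul [RHS]mxE.
exact: sqr_dot_le.
Qed.

Lemma norm2_mul_le (R : realType) m n (A : 'M[R]_(m, n)) (x : 'cV[R]_n) :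
  norm2 (A *m x) <= mxnorm2 A * norm2 x.
Proof.
have [->|x0] := eqVneq x 0.
  by rewrite mulmx0 !norm2_0 mulr0.
have nx0 : 0 < norm2 x by rewrite lt0r norm2_eq0 x0 norm2_ge0.
rewrite -[x in A *m x]norm2_scale_normalize -scalemxAr norm2Z.
rewrite ger0_norm ?norm2_ge0 // mulrC ler_pM2r //.
apply: ub_le_sup.
  exists (Num.sqrt (\sum_i norm2 (row i A)^T ^+ 2)) => _ [y /= y1 <-].
  apply: (le_trans (norm2_mul_le_frobenius A y)).
  by rewrite ler_piMr ?sqrtr_ge0.
exists ((norm2 x)^-1 *: x) => //=.
by rewrite norm2Z ger0_norm ?invr_ge0 ?norm2_ge0 // mulVf // gt_eqF.
Qed.

(** A multiple that is optimal for the stacked vectors controls both blocks at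
    once, since a block is never longer than the whole residual. *)
Lemma sin_angle_col_mx_residual (R : realType) k l (a c : 'cV[R]_k)
    (b d : 'cV[R]_l) :
  let r := norm2 (col_mx a b) * sin (angle (col_mx c d) (col_mx a b)) in
  exists mu, norm2 (a - mu *: c) <= r /\ norm2 (b - mu *: d) <= r.
Proof.
have [mu ->] := norm2_sin_angle_attained (col_mx c d) (col_mx a b).
exists mu; rewrite scale_col_mx opp_col_mx add_col_mx.
by split; rewrite -(@ler_pXn2r _ 2) ?nnegrE ?norm2_ge0 // sqr_norm2_col_mx
  ?lerDl ?lerDr sqr_ge0.
Qed.

(** * Components of the generalized singular value decomposition *)

Lemma norm2_col_orthonormal (R : realType) k l (Q : 'M[R]_(k, l)) i :
  Q^T *m Q = 1%:M -> norm2 (col i Q) = 1.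
Proof.
move=> QQ; apply/eqP; rewrite -(@eqrXn2 _ 2) ?norm2_ge0 // expr1n sqr_norm2.
apply/eqP; transitivity ((Q^T *m Q) i i); last by rewrite QQ mxE eqxx.
by rewrite mxE; apply: eq_bigr => j _; rewrite !mxE expr2.
Qed.

(** [A] and [B] factor in the same way, with [(U, al)] and [(V, be)] in the roles
    of [(Q, d)], so their actions on the columns are derived once. *)
Section GSVDFactor.
Variables (R : realType) (k n : nat) (M Q : 'M[R]_(k, n)) (d : 'rV[R]_n).
Variables (X : 'M[R]_n) (i : 'I_n).
Hypotheses (Xunit : X \in unitmx) (QQ : Q^T *m Q = 1%:M).
Hypothesis defM : M = Q *m diag_mx d *m invmx X.

Let diag_delta : diag_mx d *m delta_mx i 0 = d 0 i *: delta_mx i 0 :> 'cV_n.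
Proof.
rewrite -colE; apply/colP => j; rewrite !mxE eqxx andbT.
by case: eqVneq => [->|_]; rewrite ?mulr1n ?mulr1 // mulr0n mulr0.
Qed.

Lemma mul_gsvd_factor_col : M *m col i X = d 0 i *: col i Q.
Proof.
by rewrite defM !colE -!mulmxA mulKmx // diag_delta -scalemxAr.
Qed.

(** The vector scaled on the right is a column of the inverse transpose of [X],
    the same one for both factorisations; this is what makes [A^T *m u] and
    [B^T *m v] proportional. *)
Lemma mul_tr_gsvd_factor_col :
  M^T *m col i Q = d 0 i *: ((invmx X)^T *m delta_mx i 0).
Proof.
rewrite defM !trmx_mul tr_diag_mx colE -!mulmxA (mulmxA Q^T) QQ mul1mx.
by rewrite diag_delta -scalemxAr.
Qed.

End GSVDFactor.

Lemma gsvd_componentP (R : realType) m n p (A : 'M[R]_(m, n))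
    (B : 'M[R]_(p, n)) alpha beta u v x :
  gsvd_component A B alpha beta u v x ->
  [/\ 0 < alpha /\ 0 < beta, norm2 u = 1 /\ norm2 v = 1,
      A *m x = alpha *: u, B *m x = beta *: v
    & beta *: (A^T *m u) = alpha *: (B^T *m v)].
Proof.
move=> [U [V [X [al [be [[UU VV Xunit pos [defA defB]]]]]]]].
move=> [i [-> -> -> -> ->]]; have [al0 be0 _] := pos i.
rewrite !norm2_col_orthonormal // (mul_gsvd_factor_col i Xunit defA).
rewrite (mul_gsvd_factor_col i Xunit defB) (mul_tr_gsvd_factor_col i UU defA).
by rewrite (mul_tr_gsvd_factor_col i VV defB) !scalerA mulrC.
Qed.

Theorem theorem3p3 (R : realType) (m n p : nat)
    (A : 'M[R]_(m, n)) (B : 'M[R]_(p, n))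
    (le_nm : (n <= m)%N) (le_np : (n <= p)%N)
    (rankA : \rank A = n) (rankB : \rank B = n)
    (alpha beta : R) (u : 'cV[R]_m) (v : 'cV[R]_p) (x : 'cV[R]_n)
    (comp : gsvd_component A B alpha beta u v x) :
  let sigma := alpha / beta in
  let xa := alpha^-1 *: x in
  let z := (Num.sqrt 2)^-1 *: col_mx v xa in
  [/\ 1 / mxnorm2 A <= norm2 xa,
      pair_eigen (Btilde B) (Atilde p A) (1 / sigma) z &
      forall (vt : 'cV[R]_p) (xt : 'cV[R]_n), norm2 vt = 1 -> xt != 0 ->
        let zt := (Num.sqrt 2)^-1 *: col_mx vt xt in
        let ut := (norm2 (A *m xt))^-1 *: (A *m xt) in
        [/\ sin (angle xt x)
              <= Num.sqrt (1 + 1 / norm2 xa ^+ 2) * sin (angle zt z),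
            sin (angle vt v)
              <= Num.sqrt (1 + norm2 xa ^+ 2) * sin (angle zt z) &
            sin (angle ut u)
              <= mxnorm2 A * Num.sqrt (1 + norm2 xa ^+ 2)
                 * sin (angle zt z)]].
Proof.
have [[a0 b0] [nu nv] Ax Bx Atu] := gsvd_componentP comp.
move=> sigma xa z; have a_neq0 : alpha != 0 by rewrite gt_eqF.
have Axa : A *m xa = u by rewrite -scalemxAr Ax scalerA mulVf // scale1r.
have M_xa : 1 <= mxnorm2 A * norm2 xa by rewrite -nu -Axa norm2_mul_le.
have xa0 : 0 < norm2 xa.
  rewrite lt0r norm2_ge0 andbT; apply: contraTneq M_xa => ->.
  by rewrite mulr0 ler10.
have M0 : 0 < mxnorm2 A by rewrite -(pmulr_lgt0 _ xa0) (lt_le_trans ltr01).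
have s0 : (Num.sqrt 2)^-1 != 0 :> R by rewrite invr_neq0 // gt_eqF // sqrtr_gt0.
have nz : norm2 (col_mx v xa) = Num.sqrt (1 + norm2 xa ^+ 2).
  rewrite -[1](expr1n _ 2) -nv -sqr_norm2_col_mx sqrtr_sqr.
  by rewrite ger0_norm ?norm2_ge0.
split.
- by rewrite ler_pdivrMr // mulrC.
- split.
    rewrite scaler_eq0 negb_or s0 -norm2_eq0 nz gt_eqF // sqrtr_gt0.
    by rewrite ltr_pwDl // sqr_ge0.
  rewrite -!scalemxAr [RHS]scalerA mulrC -scalerA; congr (_ *: _).
  rewrite /Btilde /Atilde !mul_block_col !mul0mx mul1mx add0r !addr0 add0r.
  rewrite scale_col_mx /sigma div1r invf_div; congr col_mx.
    by rewrite -scalemxAr Bx scalerA mulrC.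
  by rewrite -mulmxA Axa mulrC -scalerA Atu scalerA mulVf // scale1r.
move=> vt xt nvt xt0 zt ut.
rewrite sin_angleZr // sin_angleZl //.
have [mu [resv resx]] := sin_angle_col_mx_residual v vt xa xt.
rewrite nz in resv resx; split.
- rewrite -(sin_angleZr xt x (invr_neq0 a_neq0)) -(ler_pM2l xa0) mulrA.
  apply: (le_trans (norm2_sin_angle_le mu _ _)).
  have -> : norm2 xa * Num.sqrt (1 + 1 / norm2 xa ^+ 2)
            = Num.sqrt (1 + norm2 xa ^+ 2).
    rewrite -{1}(ger0_norm (ltW xa0)) -sqrtr_sqr -sqrtrM ?sqr_ge0 //.
    by congr Num.sqrt; field; rewrite gt_eqF.
  exact: resx.
- rewrite -[leLHS]mul1r -[X in X * sin _ <= _]nv.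
  exact: le_trans (norm2_sin_angle_le mu _ _) resv.
- rewrite -[leLHS]mul1r -[X in X * sin _ <= _]nu -mulrA.
  (* [ut] is normalised, so the multiple of [ut] equal to [mu *: (A *m xt)]
     carries the factor [norm2 (A *m xt)]. *)
  apply: (le_trans (norm2_sin_angle_le (mu * norm2 (A *m xt)) _ _)).
  rewrite -scalerA norm2_scale_normalize -Axa scalemxAr -mulmxBr.
  by rewrite (le_trans (norm2_mul_le _ _)) // ler_pM2l.
Qed.
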